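(* There exist two infinite families of finite simple skew braces, denoted $B_m^{(3)}$ and $B_m^{(5)}$ for $m\ge0$, such that $$(B_m^{(3)},+)\cong A_5^{3^m},\qquad (B_m^{(5)},+)\cong A_5^{5^m}\qquad\text{for all } m\ge 0,$$ and all the multiplicative groups $(B_m^{(3)},\circ)$ and $(B_m^{(5)},\circ)$ are solvable. More generally, for every integer $n\ge2$ all of whose prime divisors lie in $\{3,5\}$ there exists a finite simple skew brace $B_n$ such that $(B_n,+)\cong A_5^n$ and $(B_n,\circ)$ is solvable.
   Context: A skew brace is a triple $(B,+,\circ)$ such that $(B,+)$ and $(B,\circ)$ are groups (neither assumed abelian) on the same set and $a\circ(b+c)=a\circ b-a+a\circ c$ for all $a,b,c\in B$. The two identity elements coincide and are denoted $0$. Its lambda map is $\lambda^B:(B,\circ)\to\mathrm{Aut}(B,+)$, $\lambda^B_a(b)=-a+a\circ b$. An ideal is a subgroup $I\le(B,+)$ with $I\trianglelefteq(B,+)$, $I\trianglelefteq(B,\circ)$ and $\lambda^B_a(I)=I$ for all $a\in B$. A non-zero skew brace is simple if its only ideals are $0$ and $B$. $A_5$ is the alternating group of degree $5$, and $A_5^n$ its $n$-fold direct power. *)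

(* Defs.v *)
From HB Require Import structures.
From mathcomp Require Import all_boot all_fingroup all_solvable.

Set Implicit Arguments.
Unset Strict Implicit.
Unset Printing Implicit Defensive.

Local Open Scope group_scope.

(* Neither operation is assumed commutative.  The two neutral elements are
   separate fields; [finSkewBrace_circ1] shows that they coincide. *)
Record finSkewBrace := FinSkewBrace {
  sb_sort :> finType;
  sb_add : sb_sort -> sb_sort -> sb_sort;
  sb_zero : sb_sort;
  sb_opp : sb_sort -> sb_sort;
  sb_circ : sb_sort -> sb_sort -> sb_sort;
  sb_one : sb_sort;
  sb_inv : sb_sort -> sb_sort;
  sb_addA : associative sb_add;
  sb_add0 : left_id sb_zero sb_add;
  sb_addN : left_inverse sb_zero sb_opp sb_add;
  sb_circA : associative sb_circ;
  sb_circ1 : left_id sb_one sb_circ;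
  sb_circV : left_inverse sb_one sb_inv sb_circ;
  sb_brace : forall a b c : sb_sort,
    sb_circ a (sb_add b c) =
    sb_add (sb_add (sb_circ a b) (sb_opp a)) (sb_circ a c)
}.

(* Copies of the carrier, so that it can bear both group structures: MathComp's
   multiplicative notation on [add_group B] is the addition of B. *)
Definition add_group (B : finSkewBrace) : Type := sb_sort B.
Definition circ_group (B : finSkewBrace) : Type := sb_sort B.

HB.instance Definition _ (B : finSkewBrace) :=
  Finite.copy (add_group B) (sb_sort B).
HB.instance Definition _ (B : finSkewBrace) :=
  Finite_isGroup.Build (add_group B) (@sb_addA B) (@sb_add0 B) (@sb_addN B).

HB.instance Definition _ (B : finSkewBrace) :=
  Finite.copy (circ_group B) (sb_sort B).
HB.instance Definition _ (B : finSkewBrace) :=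
  Finite_isGroup.Build (circ_group B) (@sb_circA B) (@sb_circ1 B) (@sb_circV B).

Lemma finSkewBrace_circ1 (B : finSkewBrace) : sb_one B = sb_zero B.
Proof.
have := sb_brace (sb_one B) (sb_zero B) (sb_zero B).
rewrite !sb_circ1 !sb_add0 => E.
have /(congr1 (fun x : add_group B => x^-1)) : 
  (1 : add_group B) = (sb_one B : add_group B)^-1.
  by rewrite [LHS]E; exact: (mulg1 ((sb_one B : add_group B)^-1)).
by rewrite invgK invg1 => <-.
Qed.

Definition sb_lambda (B : finSkewBrace) (a b : B) : B :=
  sb_add (sb_opp a) (sb_circ a b).

(* [I] is a subgroup of (B,+); its underlying set is retyped in [circ_group B],
   which has the same elements, to be tested as a subgroup of (B,\circ). *)
Definition sb_ideal (B : finSkewBrace) (I : {group add_group B}) : Prop :=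
  [/\ I <| [set: add_group B],
      group_set (I : {set circ_group B}),
      (I : {set circ_group B}) <| [set: circ_group B]
    & forall a : B, [set (sb_lambda a x : add_group B) | x in I] = I].

Definition sb_simple (B : finSkewBrace) : Prop :=
  (exists x : B, x <> sb_zero B) /\
  (forall I : {group add_group B},
     sb_ideal I -> I :=: 1 \/ I :=: [set: add_group B]).

Definition A5_power (n : nat) : {set {dffun 'I_n -> {perm 'I_5}}} :=
  setXn (fun _ : 'I_n => 'Alt_('I_5)).

(* Main.v *)
Require Import Defs.
From mathcomp Require Import all_boot all_fingroup all_solvable.
From mathcomp Require Import all_algebra ring.

(* A_5 is the exact product of A_4, the stabiliser of a point, and C_5, so that
   [a o b = x b y] for [a = x y] makes A_5 a skew brace with multiplicative group
   A_4 x C_5.  On A_5^J one may moreover let [a] permute the coordinates of [b],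
   by a permutation [tau_a] which depends only on the images of the coordinates
   of [a] in A_4 / V_4 x C_5 = Z_3 x Z_5: the result is still a skew brace as
   soon as [tau (u + v \o tau_u) = tau_u * tau_v].  If [tau] is transitive on J,
   no proper subproduct of A_5^J is an ideal and the brace is simple.  A perfect
   subgroup of the multiplicative group is killed first by [tau], then by the
   projection to C_5 and finally by the one to A_4, so this group is solvable.

   Such a [tau], with labels in Z_q, exists on q^k points: take for J the ring
   Z_q[x]/(x^k), where [t] stands for the element [1 + x t] of the group
   1 + x Z_q[x]/(x^(k+1)), and let [tau_u] be the inverse of the translation by
   the element [r = \sum_t u_t (1 + x t)].  Products of such [tau] give the
   numbers of points 3^a 5^b. *)

Set Implicit Arguments.
Unset Strict Implicit.
Unset Printing Implicit Defensive.

Import GRing.Theory.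

Local Open Scope ring_scope.

(** * Permutation cocycles: definition, trivial case and products *)

(** [cocycleD] makes the twisted product associative, [cocycle_comm] makes the group of twists
    abelian, hence solvable, and [cocycle_trans] serves simplicity. *)
Record perm_cocycle (Z : zmodType) (J : finType) := PermCocycle {
  cocycle_fun :> {ffun J -> Z} -> {perm J};
  cocycleD : forall u v : {ffun J -> Z},
    cocycle_fun (u + [ffun j => v (cocycle_fun u j)])
      = (cocycle_fun u * cocycle_fun v)%g;
  cocycle_comm : forall u v, commute (cocycle_fun u) (cocycle_fun v);
  cocycle_trans : forall i j, exists u, cocycle_fun u i = j
}.

Section UnitCocycle.

Variable Z : zmodType.

Let tau (u : {ffun unit -> Z}) : {perm unit} := 1%g.

Definition unit_cocycle : perm_cocycle Z unit.
Proof.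
exists tau => [u v|u v|[] []]; first by rewrite mulg1.
  exact: commute1.
by exists 0; rewrite perm1.
Defined.

End UnitCocycle.

Section ProdCocycle.

Variables (Z1 Z2 : zmodType) (J1 J2 : finType).
Variables (tau1 : perm_cocycle Z1 J1) (tau2 : perm_cocycle Z2 J2).

Implicit Type u : {ffun J1 * J2 -> Z1 * Z2}.

(** Summing over a fibre makes the result blind to permutations of that fibre, so each factor sees
    only its own cocycle identity. *)
Let pr1 u : {ffun J1 -> Z1} := [ffun i => \sum_j (u (i, j)).1].
Let pr2 u : {ffun J2 -> Z2} := [ffun j => \sum_i (u (i, j)).2].

Let act (s1 : {perm J1}) (s2 : {perm J2}) (k : J1 * J2) := (s1 k.1, s2 k.2).

Let act_inj s1 s2 : injective (act s1 s2).
Proof. by move=> [i j] [i' j'] [/perm_inj-> /perm_inj->]. Qed.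

Let tau u : {perm J1 * J2} := perm (@act_inj (tau1 (pr1 u)) (tau2 (pr2 u))).

Let tauD (u v : {ffun J1 * J2 -> Z1 * Z2}) :
  tau (u + [ffun k => v (tau u k)]) = (tau u * tau v)%g.
Proof.
have E1 : pr1 (u + [ffun k => v (tau u k)])
    = pr1 u + [ffun i => pr1 v (tau1 (pr1 u) i)].
  apply/ffunP=> i; rewrite !ffunE.
  rewrite [X in _ = _ + X](reindex_inj (@perm_inj _ (tau2 (pr2 u)))).
  rewrite -big_split /=; apply: eq_bigr => j _.
  by rewrite !ffunE permE.
have E2 : pr2 (u + [ffun k => v (tau u k)])
    = pr2 u + [ffun j => pr2 v (tau2 (pr2 u) j)].
  apply/ffunP=> j; rewrite !ffunE.
  rewrite [X in _ = _ + X](reindex_inj (@perm_inj _ (tau1 (pr1 u)))).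
  rewrite -big_split /=; apply: eq_bigr => i _.
  by rewrite !ffunE permE.
by apply/permP => k; rewrite permM !permE /act /= E1 E2 !cocycleD !permM.
Qed.

Let tauC u v : commute (tau u) (tau v).
Proof.
apply/permP => k; rewrite !permM !permE /act /= -!permM.
by rewrite (cocycle_comm tau1 (pr1 u) (pr1 v)) (cocycle_comm tau2 (pr2 u) (pr2 v)).
Qed.

Let tau_trans i j : exists u, tau u i = j.
Proof.
have [u1 E1] := cocycle_trans tau1 i.1 j.1.
have [u2 E2] := cocycle_trans tau2 i.2 j.2.
(* [u1] and [u2] sit on the slices through [i], so each fibre sum reduces to one term. *)
pose u : {ffun J1 * J2 -> Z1 * Z2} :=
  [ffun k => (if k.2 == i.2 then u1 k.1 else 0, if k.1 == i.1 then u2 k.2 else 0)].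
exists u; rewrite permE /act.
have -> : pr1 u = u1.
  apply/ffunP=> a; rewrite ffunE.
  under eq_bigr do rewrite ffunE /=.
  by rewrite -big_mkcond big_pred1_eq.
have -> : pr2 u = u2.
  apply/ffunP=> a; rewrite ffunE.
  under eq_bigr do rewrite ffunE /=.
  by rewrite -big_mkcond big_pred1_eq.
by rewrite E1 E2; case: (j).
Qed.

Definition prod_cocycle : perm_cocycle (Z1 * Z2)%type (J1 * J2)%type :=
  PermCocycle tauD tauC tau_trans.

End ProdCocycle.

(** * Transitive cocycles on truncated polynomial rings *)

Section PolyCocycle.

Variables (R : finComNzRingType) (n : nat).

Local Notation A := {poly %/ 'X^(n.+1) : {poly R}}.
Local Notation x := ('qX : A).

(** The group law of the elements [1 + x t], written on [t]:
    [(1 + x r) (1 + x t) = 1 + x (act r t)]. *)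
Let act (r t : A) : A := r + (1 + x * r) * t.

Let actC r t : act r t = act t r.
Proof. rewrite /act; ring. Qed.

Let actA r s t : act r (act s t) = act (act r s) t.
Proof.
rewrite /act; ring.
Qed.

Let X_nilp : x ^+ n.+1 = 0.
Proof.
have E : in_qpoly 'X^(n.+1) ('X^(n.+1) : {poly R}) = x ^+ n.+1.
  by rewrite rmorphXn.
rewrite -E; apply: val_inj => /=.
by rewrite mk_monic_Xn Pdiv.RingMonic.rmodpp ?monicXn.
Qed.

(** [1 + x r] is a unit because [x] is nilpotent: if it kills [d] then [d = - (x r) d], and
    iterating gives 0. *)
Let act_inj r : injective (act r).
Proof.
move=> s t /addrI; pose d := s - t => E.
have d0 : d = - (x * r) * d.
  apply/eqP; rewrite -subr_eq0; apply/eqP.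
  transitivity ((1 + x * r) * s - (1 + x * r) * t); first by rewrite /d; ring.
  by rewrite E subrr.
have dX m : d = (- (x * r)) ^+ m * d.
  by elim: m => [|m IH]; rewrite ?mul1r // [X in X * _]exprSr -mulrA -d0.
apply/eqP; rewrite -subr_eq0 -/d (dX n.+1).
rewrite [X in X * _]exprNn [X in _ * X * _]exprMn X_nilp.
by rewrite mul0r mulr0 mul0r.
Qed.

Let wt (u : {ffun A -> R}) : A := \sum_t u t *: (1 + x * t).

Let tau u : {perm A} := (perm (@act_inj (wt u)))^-1%g.

Let tauK u t : act (wt u) (tau u t) = t.
Proof. by rewrite -[LHS](permE (@act_inj _)) permKV. Qed.

Let tauE u s t : act (wt u) s = t -> tau u t = s.
Proof. by move=> <-; apply: (@act_inj (wt u)); rewrite tauK. Qed.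

Let wtD (u v : {ffun A -> R}) : wt (u + [ffun t => v (tau u t)]) = act (wt u) (wt v).
Proof.
rewrite /wt; under eq_bigr do rewrite !ffunE scalerDl.
rewrite big_split /= /act -/(wt u) -/(wt v); congr (_ + _).
(* For [t = act (wt u) s] the weight factors as [1 + x t = (1 + x (wt u)) (1 + x s)]; hence the
   inverse in [tau]. *)
rewrite (reindex_inj (@perm_inj _ (tau u)^-1%g)) /= big_distrr /=.
apply: eq_bigr => t _; rewrite permKV -scalerAr; congr (_ *: _).
rewrite /tau invgK permE /act.
ring.
Qed.

Let tauD (u v : {ffun A -> R}) : tau (u + [ffun t => v (tau u t)]) = (tau u * tau v)%g.
Proof.
apply/permP => t; apply: tauE.
by rewrite wtD permM -actA tauK tauK.
Qed.

Let tauC u v : commute (tau u) (tau v).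
Proof.
apply/permP => t; rewrite !permM; apply: tauE; apply/esym/tauE.
by rewrite actA [act (wt u) _]actC -actA !tauK.
Qed.

(* The weights [1 + x t] span [A]: write [a = c + x b] and use [1 = 1 + x 0]. *)
Let wt_surj a : exists u, wt u = a.
Proof.
have [c [b Ea]] : exists c : R, exists b : A, a = c%:A + x * b.
  have -> : a = in_qpoly 'X^(n.+1) (val a).
    by apply: val_inj; rewrite /= [RHS]in_qpoly_small ?size_mk_monic.
  elim/poly_ind: (val a) => [|p c _].
    by exists 0, 0; rewrite in_qpoly0 scale0r mulr0 addr0.
  exists c, (in_qpoly 'X^(n.+1) p).
  by rewrite in_qpolyD in_qpolyM mulrC addrC -alg_polyC in_qpolyZ in_qpoly1.
(* [(c - 1) + (1 + x b) = c + x b]; as the labels are added, [b = 0] is no special case. *)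
exists ([ffun t => if t == 0 then c - 1 else 0] + [ffun t => if t == b then 1 else 0]).
rewrite /wt; under eq_bigr do rewrite !ffunE scalerDl
  !(fun_if (fun k => k *: _)) !scale0r.
rewrite big_split /= -!big_mkcond !big_pred1_eq mulr0 addr0 Ea scale1r.
by rewrite scalerBl scale1r addrA subrK.
Qed.

Let tau_trans i j : exists u, tau u i = j.
Proof.
(* The weight [r] must satisfy [act r j = i]; by commutativity it is the preimage of [i] under
   [act j]. *)
pose s := perm (@act_inj j).
have [u Eu] := wt_surj ((s^-1)%g i).
by exists u; apply: tauE; rewrite actC Eu -[LHS](permE (@act_inj j)) permKV.
Qed.

Definition poly_cocycle : perm_cocycle R A := PermCocycle tauD tauC tau_trans.

Lemma card_poly_cocycle : #|{: A}| = (#|R| ^ n.+1)%N.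
Proof. by rewrite card_monic_qpoly ?size_polyXn ?monicXn. Qed.

End PolyCocycle.

Local Close Scope ring_scope.
Local Open Scope group_scope.

(** * Skew braces from a labelled factorization and a cocycle *)

Record labelled_factorization (gT : finGroupType) (Z : zmodType) :=
  LabelledFactorization {
  facl : gT -> gT;
  facr : gT -> gT;
  label : gT -> Z;
  facK : forall g, facl g * facr g = g;
  faclM : forall a b, facl (facl a * b * facr a) = facl a * facl b;
  facrM : forall a b, facr (facl a * b * facr a) = facr b * facr a;
  labelM : forall a b, label (facl a * b * facr a) = (label a + label b)%R;
  label_onto : forall z, exists g, label g = z
}.

Section TwistedPower.

Variables (gT : finGroupType) (Z : zmodType) (J : finType).
Variables (fac : labelled_factorization gT Z) (tau : perm_cocycle Z J).

Local Notation px := (facl fac).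
Local Notation py := (facr fac).
Local Notation B := {ffun J -> gT}.

Implicit Types a b c : B.

Definition twist a : {perm J} := tau [ffun j => label fac (a j)].

Definition power_mul a b : B := [ffun j => a j * b j].
Definition power_inv a : B := [ffun j => (a j)^-1].
Definition power_one : B := [ffun => 1].

Definition twisted_circ a b : B := [ffun j => px (a j) * b (twist a j) * py (a j)].
Definition twisted_inv a : B :=
  [ffun j => let i := (twist a)^-1 j in (px (a i))^-1 * (py (a i))^-1].

Lemma facl1 : px 1 = 1.
Proof.
by apply: (mulgI (px 1)); rewrite -faclM mulg1 facK.
Qed.

Lemma facr1 : py 1 = 1.
Proof. by rewrite -[LHS]mul1g -{1}facl1 facK. Qed.

Lemma twistM a b : twist (twisted_circ a b) = twist a * twist b.
Proof.
rewrite /twist -cocycleD; congr (tau _); apply/ffunP=> j.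
by rewrite !ffunE labelM.
Qed.

Lemma twist1 : twist power_one = 1.
Proof.
apply: (mulgI (twist power_one)); rewrite -twistM mulg1; congr twist.
by apply/ffunP => j; rewrite !ffunE facl1 facr1 !mulg1.
Qed.

Lemma power_mulA : associative power_mul.
Proof. by move=> a b c; apply/ffunP => j; rewrite !ffunE mulgA. Qed.

Lemma power_mul1 : left_id power_one power_mul.
Proof. by move=> a; apply/ffunP => j; rewrite !ffunE mul1g. Qed.

Lemma power_mulV : left_inverse power_one power_inv power_mul.
Proof. by move=> a; apply/ffunP => j; rewrite !ffunE mulVg. Qed.

Lemma twisted_circA : associative twisted_circ.
Proof.
move=> a b c; apply/ffunP => j.
by rewrite [LHS]ffunE [RHS]ffunE twistM permM !ffunE faclM facrM !mulgA.
Qed.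

Lemma twisted_circ1 : left_id power_one twisted_circ.
Proof.
by move=> a; apply/ffunP => j; rewrite !ffunE twist1 perm1 facl1 facr1 mul1g mulg1.
Qed.

Lemma twisted_circr1 : right_id power_one twisted_circ.
Proof. by move=> a; apply/ffunP => j; rewrite !ffunE mulg1 facK. Qed.

Lemma twisted_circrV : right_inverse power_one twisted_inv twisted_circ.
Proof.
by move=> a; apply/ffunP => j; rewrite !ffunE permK mulKVg mulVg.
Qed.

(** [twisted_inv] is visibly a right inverse; being itself right invertible, [b] has [a] as its
    right inverse. *)
Lemma twisted_circV : left_inverse power_one twisted_inv twisted_circ.
Proof.
move=> a; set b := twisted_inv a.
have Ebc : twisted_circ b (twisted_inv b) = power_one := twisted_circrV b.
rewrite -[a in LHS]twisted_circr1 -[in LHS]Ebc [twisted_circ a _]twisted_circA.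
by rewrite twisted_circrV twisted_circ1.
Qed.

(** With [a = x y] the middle cancels: [x b y (x y)^-1 x c y = x b c y]. *)
Lemma twisted_brace a b c :
  twisted_circ a (power_mul b c)
    = power_mul (power_mul (twisted_circ a b) (power_inv a)) (twisted_circ a c).
Proof.
apply/ffunP => j; rewrite !ffunE -[X in _ = _ * X^-1 * _](facK fac) invMg.
by rewrite !mulgA mulgK mulgKV.
Qed.

Definition twisted_power : finSkewBrace :=
  FinSkewBrace power_mulA power_mul1 power_mulV
    twisted_circA twisted_circ1 twisted_circV twisted_brace.

Lemma twisted_lambdaE (a b : twisted_power) j :
  (sb_lambda a b : B) j
    = (b : B) (twist a j) ^ py ((a : B) j).
Proof.
rewrite /sb_lambda /= !ffunE -[X in X^-1 * _](facK fac) invMg.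
by rewrite conjgE !mulgA mulgKV.
Qed.

(** * Simplicity of the twisted power *)

Definition single j (g : gT) : B := [ffun i => if i == j then g else 1].

Lemma group_gen_single (I : {group add_group twisted_power}) :
  (forall j g, (single j g : add_group twisted_power) \in I) -> I :=: setT.
Proof.
move=> sI; apply/eqP; rewrite eqEsubset subsetT; apply/subsetP => b _.
pose cut (s : seq J) : B := [ffun j => if j \in s then (b : B) j else 1].
have E : b = cut (enum J) by apply/ffunP => j; rewrite ffunE mem_enum.
rewrite E; elim: {E}(enum J) (enum_uniq J) => [_|k s IH /= /andP[ks us]].
  have -> // : cut [::] = power_one by apply/ffunP=> j; rewrite !ffunE.
  exact: (group1 I).
have -> : cut (k :: s) = power_mul (single k ((b : B) k)) (cut s).
  apply/ffunP => j; rewrite !ffunE inE; have [->|_] := eqVneq; last by rewrite mul1g.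
  by rewrite (negPf ks) mulg1.
by apply: (@groupM _ I); [apply: sI | apply: IH].
Qed.

Lemma single_comm (a : add_group twisted_power) j g :
  [~ a, (single j g : add_group twisted_power)] = single j [~ (a : B) j, g].
Proof.
have -> : [~ a, (single j g : add_group twisted_power)]
  = power_mul (power_inv a)
      (power_mul (power_inv (single j g)) (power_mul a (single j g))).
  by [].
apply/ffunP=> i; rewrite !ffunE; have [->|_] := eqVneq; first by [].
by rewrite invg1 mul1g mulg1 mulVg.
Qed.

(** The [x] with [single j x] in [I] form a normal subgroup of a simple group. *)
Lemma single_normal_closure (I : {group add_group twisted_power}) j h :
  simple [set: gT] -> I <| [set: add_group twisted_power] ->
  h != 1 -> (single j h : add_group twisted_power) \in I ->
  forall g, (single j g : add_group twisted_power) \in I.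
Proof.
move=> simG nI h1 hI.
have singleM x y : single j (x * y) = power_mul (single j x) (single j y).
  by apply/ffunP=> i; rewrite !ffunE; case: eqP; rewrite ?mulg1.
have singleV x : single j x^-1 = power_inv (single j x).
  by apply/ffunP=> i; rewrite !ffunE; case: eqP; rewrite ?invg1.
have gN : group_set [set x | (single j x : add_group twisted_power) \in I].
  apply/group_setP; split=> [|x y]; rewrite !inE.
    have -> : single j 1 = power_one by apply/ffunP=> i; rewrite !ffunE if_same.
    exact: (group1 I).
  by rewrite singleM; apply: (@groupM _ I).
pose N := Group gN.
have nN : N <| [set: gT].
  apply/andP; split; first exact: subsetT.
  apply/subsetP => g _; rewrite inE; apply/subsetP => _ /imsetP[x xN ->].
  move: xN; rewrite !inE conjgE !singleM singleV => xI.
  apply: etrans xI; apply: (memJ_norm (single j x : add_group twisted_power)).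
  exact: subsetP (normal_norm nI) (single j g) (in_setT _).
have [_ /(_ N nN) [N1 | NT] g] := simpleP _ simG.
  suff : h \in N by rewrite N1 inE (negPf h1).
  by rewrite inE.
have : g \in N by rewrite NT inE.
by rewrite inE.
Qed.

(* A nontrivial ideal contains a commutator [b, single j g], hence all of
   [single j g]; [twist] then spreads this to every coordinate. *)
Lemma twisted_simple :
  (0 < #|J|)%N -> simple [set: gT] -> ~~ abelian [set: gT] -> sb_simple twisted_power.
Proof.
move=> /card_gt0P[j0 _] simG nabG; have [ntG minG] := simpleP _ simG.
split=> [|I [nI _ _ lI]].
  have [g _ g1] := trivgPn _ ntG.
  exists (single j0 g) => /ffunP/(_ j0); rewrite !ffunE eqxx => gE.
  by rewrite gE eqxx in g1.
have [->|/trivgPn[b bI b1]] := eqVneq (I : {set _}) 1; [by left | right].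
have [j bj1] : exists j, (b : B) j != 1.
  apply/existsP; apply: contraR b1 => /existsPn b1; apply/eqP/ffunP => j.
  by rewrite ffunE; apply/eqP; move: (b1 j); rewrite negbK.
(* A simple non-abelian group has trivial centre. *)
have [g bg1] : exists g, [~ (b : B) j, g] != 1.
  apply/existsP; apply: contraR nabG => /existsPn bC.
  have ZbT : (b : B) j \in 'Z([set: gT]).
    apply/centerP; split=> // g _; apply/commgP; move: (bC g); exact: negbNE.
  have [Z1|<-] := minG _ (center_normal [set: gT]); last exact: center_abelian.
  by move: ZbT; rewrite Z1 inE (negPf bj1).
have jI : forall h, (single j h : add_group twisted_power) \in I.
  apply: single_normal_closure bg1 _ => //.
  rewrite -single_comm commgEl groupM ?groupV // memJ_norm //.
  exact: subsetP (normal_norm nI) _ (in_setT _).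
apply: group_gen_single => i.
have [u ui] := cocycle_trans tau i j.
have [a au] := fin_all_exists (fun k => label_onto fac (u k)).
pose d : B := [ffun k => a k].
have di : twist d i = j.
  by rewrite -ui; congr (tau _ _); apply/ffunP => k; rewrite !ffunE au.
have [h _ h1] := trivgPn _ ntG.
apply: (@single_normal_closure I i (h ^ py (d i))) => //.
  by apply: contra h1 => /eqP hE; rewrite -(conjg_eq1 _ (py (d i))) hE.
suff: (single i (h ^ py (d i)) : add_group twisted_power)
    \in [set (sb_lambda (d : twisted_power) x : add_group twisted_power) | x in I].
  by rewrite lI.
(* The lambda map of [d] reads coordinate [twist d k], which is [j] exactly when [k = i]. *)
have -> : single i (h ^ py (d i)) = sb_lambda (d : twisted_power) (single j h).
  apply/ffunP => k; rewrite twisted_lambdaE !ffunE -di (inj_eq perm_inj).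
  by case: eqP => [->|_]; rewrite ?conj1g // ffunE.
by apply: imset_f; apply: jI.
Qed.

(** * Solvability of the multiplicative group, and the additive group *)

(** By definition, [solvable] means that every subgroup contained in its own commutator subgroup is
    trivial. *)
Lemma solvable_perfect_eq1 (rT : finGroupType) (H K : {group rT}) :
  H \subset K -> solvable K -> H \subset [~: H, H] -> H :=: 1.
Proof.
move=> sHK solK pH; apply/eqP.
by move/forall_inP: (solvableS sHK solK) => /(_ H); rewrite subsetI subxx pH => /(_ isT).
Qed.

(** Multiplicativity is asked on [H] only: the coordinate projections become multiplicative once
    [twist] is trivial on [H]. *)
Lemma morphim_perfect_eq1 (aT rT : finGroupType) (H : {group aT}) (K : {group rT})
    (f : aT -> rT) :
  {in H &, {morph f : x y / x * y}} -> (forall x, x \in H -> f x \in K) ->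
  solvable K -> H \subset [~: H, H] -> forall x, x \in H -> f x = 1.
Proof.
move=> fM fK solK pH x xH; pose phi := Morphism fM.
have sK : phi @* H \subset K.
  by apply/subsetP => _ /morphimP[y _ yH ->]; apply: fK.
have pK : phi @* H \subset [~: phi @* H, phi @* H].
  by rewrite -morphimR // morphimS.
have /trivgP := solvable_perfect_eq1 sK solK pK.
move/subsetP/(_ (phi x)); rewrite mem_morphim // => /(_ isT).
by move/set1P.
Qed.

Lemma twisted_solvable (X Y : {group gT}) :
  solvable X -> solvable Y -> (forall g, px g \in X) -> (forall g, py g \in Y) ->
  solvable [set: circ_group twisted_power].
Proof.
move=> solX solY pX pY; apply/forall_inP => H; rewrite subsetI subsetT /= => pH.
have solT : solvable <<[set twist a | a : B]>>.
  apply: abelian_sol; rewrite abelian_gen.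
  apply/centsP=> _ /imsetP[a _ ->] _ /imsetP[b _ ->].
  exact: cocycle_comm.
have twist_triv a : a \in H -> twist a = 1.
  apply: (@morphim_perfect_eq1 (circ_group twisted_power) _ H _ twist) solT pH a.
    by move=> a b _ _; apply: twistM.
  by move=> a _; apply/mem_gen/imset_f.
(* [facr] reverses products, so its inverse is the morphism to use. *)
have facr_triv j a : a \in H -> py ((a : B) j) = 1.
  move=> aH; apply/eqP; rewrite -invg_eq1; apply/eqP; move: a aH.
  apply: (@morphim_perfect_eq1 (circ_group twisted_power) _ H _
    (fun a => (py ((a : B) j))^-1)) solY pH.
    move=> a b aH bH.
    have -> : a * b = twisted_circ a b by [].
    by rewrite ffunE (twist_triv a aH) perm1 facrM invMg.
  by move=> a _; rewrite groupV.
have facl_triv j a : a \in H -> px ((a : B) j) = 1.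
  move: a; apply: (@morphim_perfect_eq1 (circ_group twisted_power) _ H _
    (fun a => px ((a : B) j))) solX pH.
    move=> a b aH bH.
    have -> : a * b = twisted_circ a b by [].
    by rewrite ffunE (twist_triv a aH) perm1 faclM.
  by move=> a _.
apply/eqP/trivgP/subsetP => a aH; apply/set1P/ffunP => j.
by rewrite -(facK fac ((a : B) j)) facl_triv // facr_triv // mulg1 ffunE.
Qed.

Lemma twisted_isog (rT : finGroupType) (K : {group rT}) n :
  [set: gT] \isog K -> #|J| = n ->
  [set: add_group twisted_power] \isog setXn (fun _ : 'I_n => K).
Proof.
move=> /isogP[f injf imf] cardJ.
pose h (i : 'I_n) : J := enum_val (cast_ord (esym cardJ) i).
pose h' (j : J) : 'I_n := cast_ord cardJ (enum_rank j).
have hK : cancel h' h by move=> j; rewrite /h cast_ordK enum_rankK.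
have h'K : cancel h h' by move=> j; rewrite /h' enum_valK cast_ordKV.
pose F (b : add_group twisted_power) : {dffun 'I_n -> rT} :=
  [ffun i => f ((b : B) (h i))].
have FM : {in [set: add_group twisted_power] &, {morph F : a b / a * b}}.
  by move=> a b _ _; apply/ffunP => i; rewrite !ffunE -morphM ?inE.
apply/isogP; exists (Morphism FM).
  apply/injmP => a b _ _ /ffunP E; apply/ffunP => j.
  have := E (h' j); rewrite !ffunE hK; apply: (injmP injf); exact: in_setT.
apply/setP => y; rewrite in_setXn; apply/morphimP/forallP => [[b _ _ ->] i | yK].
  by rewrite ffunE -imf mem_morphim ?inE.
have [b bE] : exists b : {ffun J -> gT}, forall j, f (b j) = y (h' j).
  have /fin_all_exists[b bE] : forall j, exists x, f x = y (h' j).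
    by move=> j; have := yK (h' j); rewrite -imf => /morphimP[x _ _ ->]; exists x.
  by exists [ffun j => b j] => j; rewrite ffunE.
exists (b : add_group twisted_power); rewrite ?inE //.
by apply/ffunP=> i; rewrite ffunE bE h'K.
Qed.

End TwistedPower.

(** * The action of A_4 on the three splittings *)

(* The three splittings of {1,2,3,4} into two pairs, indexed by 'Z_3: the pair
   {i, j} belongs to the splitting with index [pairing i j]. *)
Definition pairing (i j : 'I_5) : 'Z_3 :=
  match (i + j)%N with 3 | 7 => 0%R | 4 | 6 => 1%R | _ => 2%:R%R end.

Local Notation point k := (@Ordinal 5 k isT).

(* On the splittings a permutation acts by an affine map of Z_3 whose linear part
   is its signature; it suffices to check this on transpositions. *)
Lemma pairing_lift_perm (s : {perm 'I_4}) (i j : 'I_4) : i != j ->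
  (pairing (lift ord0 (s i)) (lift ord0 (s j)) =
    (-1) ^+ odd_perm s * pairing (lift ord0 i) (lift ord0 j)
    + pairing (lift ord0 (s ord0)) (lift ord0 (s (@Ordinal 4 1 isT))))%R.
Proof.
have [ts -> _] := prod_tpermP s.
elim: ts i j => [|[a b] ts IH] i j ij.
  rewrite big_nil odd_perm1 !perm1 expr0 mul1r.
  (* For the identity the constant is [pairing] of 1 and 2, which is 0. *)
  by apply: val_inj; rewrite /= modn_small ?addn0 //; case: (pairing _ _).
rewrite big_cons !permM IH ?(inj_eq perm_inj) // [in RHS]IH ?(inj_eq perm_inj) //=.
rewrite odd_permM odd_tperm signr_addb addrA; congr (_ + _)%R.
rewrite [((-1) ^+ _ * (-1) ^+ _)%R]mulrC -mulrA -mulrDr; congr (_ * _)%R.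
rewrite !permE /=; apply/eqP; move: ij; apply/implyP.
(* The sign and constant of [ts] have cancelled; the formula for [tperm a b] alone is checked on all
   points. *)
case: a => [[|[|[|[|//]]]] ?]; case: b => [[|[|[|[|//]]]] ?];
  case: i => [[|[|[|[|//]]]] ?]; case: j => [[|[|[|[|//]]]] ?];
  by vm_compute.
Qed.

Lemma lift_perm_exists (n : nat) (x : {perm 'I_n.+1}) :
  x ord0 = ord0 -> exists s : {perm 'I_n}, x = lift_perm ord0 ord0 s.
Proof.
move=> x0.
have E i : exists j, x (lift ord0 i) = lift ord0 j.
  have : ord0 != x (lift ord0 i) by rewrite -{1}x0 (inj_eq perm_inj) neq_lift.
  by case/unlift_some => j -> _; exists j.
have [f fE] := fin_all_exists E.
have f_inj : injective f.
  by move=> i j ij; apply/(@lift_inj _ ord0)/(@perm_inj _ x); rewrite !fE ij.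
exists (perm f_inj); apply/permP => k.
have [j ->|->] := unliftP ord0 k; first by rewrite lift_perm_lift permE fE.
by rewrite lift_perm_id x0.
Qed.

(** An even permutation has linear part 1, so it translates the splittings. *)
Lemma pairing_even (x : {perm 'I_5}) (i j : 'I_5) :
  x ord0 = ord0 -> ~~ odd_perm x -> i != ord0 -> j != ord0 -> i != j ->
  (pairing (x i) (x j) = pairing i j + pairing (x (point 1)) (x (point 2)))%R.
Proof.
move=> /lift_perm_exists[s ->]; rewrite odd_lift_perm /= => even_s.
case: (unliftP ord0 i) => [i' ->|-> //] _; case: (unliftP ord0 j) => [j' ->|-> //] _.
rewrite (inj_eq (@lift_inj 5 ord0)) => ij.
have -> : point 1 = lift ord0 (ord0 : 'I_4) by apply: val_inj.
have -> : point 2 = lift ord0 (@Ordinal 4 1 isT) by apply: val_inj.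
by rewrite !lift_perm_lift (@pairing_lift_perm s i' j' ij) (negPf even_s) expr0 mul1r.
Qed.

(** * The labelled factorization of A_5 *)

Definition A5 : finGroupType := subg_of 'Alt_('I_5).

Definition shift (i : 'I_5) : {perm 'I_5} := perm (@addIr _ i).

Lemma shiftD i j : shift (i + j)%R = shift i * shift j.
Proof. by apply/permP => k; rewrite permM !permE addrA. Qed.

(** In Z_5 one has [i = 6 i], so each shift is a square. *)
Lemma shift_even i : shift i \in 'Alt_('I_5).
Proof.
have -> : i = (i *+ 3 + i *+ 3)%R.
  by rewrite -mulrnDr -[i in LHS]mulr1n; apply: val_inj; case: i => [[|[|[|[|[|//]]]]] ?].
by rewrite shiftD Alt_even odd_permM addbb.
Qed.

Definition rot (i : 'I_5) : A5 := subg _ (shift i).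

Lemma rotD i j : rot (i + j)%R = rot i * rot j.
Proof. by rewrite /rot shiftD morphM ?shift_even. Qed.

Definition ev (g : A5) (i : 'I_5) : 'I_5 := sgval g i.

Lemma evM g h i : ev (g * h) i = ev h (ev g i).
Proof. by rewrite /ev morphM ?inE // permM. Qed.

Lemma ev1 i : ev 1 i = i.
Proof. by rewrite /ev morph1 perm1. Qed.

Lemma ev_rot i j : ev (rot i) j = (j + i)%R.
Proof. by rewrite /ev subgK ?shift_even // permE. Qed.

Definition A5_facr g := rot (ev g ord0).
Definition A5_facl g := g * (A5_facr g)^-1.

Lemma A5_facK g : A5_facl g * A5_facr g = g.
Proof. exact: mulgKV. Qed.

Lemma ev_facl0 g : ev (A5_facl g) ord0 = ord0.
Proof.
apply: (@perm_inj _ (sgval (A5_facr g))).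
rewrite -[LHS]/(ev (A5_facr g) _) -[RHS]/(ev (A5_facr g) _).
by rewrite -evM A5_facK ev_rot add0r.
Qed.

Lemma ev_facM a b : ev (A5_facl a * b * A5_facr a) ord0 = (ev a ord0 + ev b ord0)%R.
Proof. by rewrite 2!evM ev_facl0 ev_rot addrC. Qed.

Lemma A5_facrM a b : A5_facr (A5_facl a * b * A5_facr a) = A5_facr b * A5_facr a.
Proof. by rewrite /A5_facr ev_facM addrC rotD. Qed.

Lemma A5_faclM a b : A5_facl (A5_facl a * b * A5_facr a) = A5_facl a * A5_facl b.
Proof.
by rewrite {1}/A5_facl A5_facrM invMg !mulgA mulgK -mulgA.
Qed.

Lemma A4_group_set : group_set [set g : A5 | ev g ord0 == ord0].
Proof.
apply/group_setP; split=> [|g h]; rewrite !inE ?ev1 // evM => /eqP-> /eqP->.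
exact: eqxx.
Qed.

Definition A4 : {group A5} := Group A4_group_set.

(** The pair {1, 2} has index 0, so on [A4] this is the amount by which [g] translates the
    splittings: the quotient map by V_4. *)
Definition A4_label (g : A5) : 'Z_3 := pairing (ev g (point 1)) (ev g (point 2)).

Lemma A4_labelM : {in A4 &, {morph A4_label : g h / g * h >-> (g + h)%R}}.
Proof.
move=> g h; rewrite !inE => /eqP g0 /eqP h0.
rewrite /A4_label !evM /ev pairing_even -?Alt_even ?subgP //.
- by rewrite -[X in _ != X]g0 (inj_eq perm_inj).
- by rewrite -[X in _ != X]g0 (inj_eq perm_inj).
- by rewrite (inj_eq perm_inj).
Qed.

Lemma A4_label_onto (z : 'Z_3) : exists2 g, g \in A4 & A4_label g = z.
Proof.
(* The 3-cycle 2, 3, 4 sends the pair {1, 2} to {1, 3}, of index 1; its powers give all labels. *)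
pose t : {perm 'I_5} := tperm (point 3) (point 4) * tperm (point 2) (point 3).
have tA : t \in 'Alt_('I_5) by rewrite Alt_even odd_permM !odd_tperm.
pose g : A5 := subg _ t.
have evg i : ev g i = t i by rewrite /ev subgK.
have gA4 : g \in A4 by rewrite inE evg permM !permE.
have g1 : A4_label g = 1%R by rewrite /A4_label !evg !permM !permE /=; apply: val_inj.
case: z => [[|[|[|//]]]] lt3.
- exists 1; first exact: group1.
  by rewrite /A4_label !ev1; apply: val_inj.
- by exists g => //; rewrite g1; apply: val_inj.
- exists (g * g); first exact: groupM.
  by rewrite A4_labelM // g1; apply: val_inj.
Qed.

Definition A5_label g : 'Z_3 * 'Z_5 := (A4_label (A5_facl g), ev g ord0).

Lemma facl_in_A4 g : A5_facl g \in A4.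
Proof. by rewrite inE ev_facl0. Qed.

Lemma A5_labelM a b :
  A5_label (A5_facl a * b * A5_facr a) = (A5_label a + A5_label b)%R.
Proof.
by rewrite /A5_label A5_faclM A4_labelM ?facl_in_A4 // ev_facM.
Qed.

Lemma facl_A4_rot g i : g \in A4 -> A5_facl (g * rot i) = g.
Proof.
rewrite inE => /eqP g0.
by rewrite /A5_facl /A5_facr evM g0 ev_rot add0r mulgK.
Qed.

Lemma A5_label_onto z : exists g, A5_label g = z.
Proof.
case: z => r k; have [g gA4 gr] := A4_label_onto r.
exists (g * rot k); rewrite /A5_label facl_A4_rot // gr evM ev_rot.
by move: gA4; rewrite inE => /eqP->; rewrite add0r.
Qed.

Definition A5_factorization : labelled_factorization A5 ('Z_3 * 'Z_5)%type :=
  LabelledFactorization A5_facK A5_faclM A5_facrM A5_labelM A5_label_onto.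

Lemma card_A5 : #|A5| = 60.
Proof.
have := card_Alt (T := 'I_5); rewrite card_ord => /(_ isT).
rewrite (card_isog (isog_subg _)) cardsT => E.
by apply/eqP; rewrite -(eqn_pmul2l (isT : 0 < 2)%N); apply/eqP.
Qed.

(** The factorization is a bijection from A_5 to A_4 x Z_5, and 60 = 12 * 5. *)
Lemma card_A4 : #|A4| = 12.
Proof.
pose f (g : A5) := (A5_facl g, ev g ord0).
have f_inj : injective f.
  move=> g h fgh.
  have E1 : A5_facl g = A5_facl h := congr1 fst fgh.
  have E2 : ev g ord0 = ev h ord0 := congr1 snd fgh.
  by rewrite -(A5_facK g) -(A5_facK h) E1 /A5_facr E2.
have fE : f @: [set: A5] = setX A4 [set: 'I_5].
  apply/setP => -[x i]; rewrite in_setX in_setT andbT.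
  apply/imsetP/idP => [[g _ /(congr1 fst) /= ->]|xA4].
    exact: facl_in_A4.
  exists (x * rot i); rewrite ?inE // /f facl_A4_rot // evM ev_rot.
  by move: xA4; rewrite inE => /eqP->; rewrite add0r.
have := card_imset [set: A5] f_inj; rewrite fE cardsX !cardsT card_ord card_A5 => E.
by apply/eqP; rewrite -(eqn_pmul2r (isT : 0 < 5)%N) E.
Qed.

(* The kernel of [A4_label] is the Klein four-group. *)
Lemma A4_solvable : solvable A4.
Proof.
have labM : {in A4 &, {morph A4_label : g h / g * h >-> (g * h : 'Z_3)}}.
  by move=> g h gA hA; rewrite A4_labelM.
pose lab := Morphism labM.
have imT : lab @* A4 = [set: 'Z_3].
  apply/setP => z; rewrite inE; have [g gA <-] := A4_label_onto z.
  by apply/morphimP; exists g.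
have cardK : #|'ker lab| = 4.
  have := Lagrange (normal_sub (ker_normal lab)).
  have := card_morphim lab A4; rewrite imT cardsT card_ord setIid => <-.
  rewrite card_A4 => E.
  by apply/eqP; rewrite -(eqn_pmul2r (isT : 0 < 3)%N) E.
rewrite (series_sol (ker_normal lab)); apply/andP; split.
  by apply: (@pgroup_sol _ 2); rewrite /pgroup cardK.
rewrite (isog_sol (first_isog lab)); apply: abelian_sol.
exact: FinRing.zmod_abelian.
Qed.

Lemma A5_simple : simple [set: A5].
Proof.
by rewrite -(isog_simple (isog_subg _)) simple_Alt5 ?card_ord.
Qed.

Lemma A5_nonabelian : ~~ abelian [set: A5].
Proof.
apply/negP => /abelian_sol; rewrite -(isog_sol (isog_subg _)).
by rewrite solvable_AltF ?card_ord.
Qed.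

(** * The braces with additive group A_5^(3^a 5^b) *)

(** [poly_cocycle R n] lives on [|R|^(n+1)] points, so exponent 0 is supplied by the one-point
    cocycle. *)
Definition power_cocycle (R : finComNzRingType) (n : nat) :
    {J : finType & perm_cocycle R J} :=
  if n is n'.+1 then existT _ _ (poly_cocycle R n') else existT _ _ (unit_cocycle R).

Lemma card_power_cocycle (R : finComNzRingType) (n : nat) :
  #|projT1 (power_cocycle R n)| = (#|R| ^ n)%N.
Proof. by case: n => [|n]; [rewrite card_unit | apply: card_poly_cocycle]. Qed.

Definition A5_brace (a b : nat) : finSkewBrace :=
  twisted_power A5_factorization
    (prod_cocycle (projT2 (power_cocycle 'Z_3 a)) (projT2 (power_cocycle 'Z_5 b))).

Lemma A5_braceP (a b n : nat) : n = (3 ^ a * 5 ^ b)%N ->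
  [/\ sb_simple (A5_brace a b),
      [set: add_group (A5_brace a b)] \isog A5_power n
    & solvable [set: circ_group (A5_brace a b)]].
Proof.
move=> ->.
have cardJ : #|{: projT1 (power_cocycle 'Z_3 a) * projT1 (power_cocycle 'Z_5 b)}|
    = (3 ^ a * 5 ^ b)%N.
  by rewrite card_prod !card_power_cocycle !card_ord.
split.
- apply: twisted_simple A5_simple A5_nonabelian.
  by rewrite cardJ muln_gt0 !expn_gt0.
- apply: (@twisted_isog _ _ _ _ _ _ 'Alt_('I_5)%G) cardJ.
  by rewrite isog_sym isog_subg.
- apply: (@twisted_solvable _ _ _ _ _ A4 <<[set rot i | i : 'I_5]>>).
  + exact: A4_solvable.
  + apply: abelian_sol; rewrite abelian_gen.
    apply/centsP => _ /imsetP[i _ ->] _ /imsetP[j _ ->].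
    by rewrite /commute -!rotD addrC.
  + exact: facl_in_A4.
  + by move=> g; apply/mem_gen/imset_f.
Qed.

Lemma prime_divisors_3_5 (n : nat) : (0 < n)%N ->
  (forall p : nat, prime p -> p %| n -> p = 3 \/ p = 5) ->
  exists a b, n = (3 ^ a * 5 ^ b)%N.
Proof.
elim/ltn_ind: n => n IH n_gt0 prn.
have [n_le1|n_gt1] := leqP n 1.
  by exists 0, 0; apply/eqP; rewrite eqn_leq n_le1.
have pdvd := pdiv_dvd n.
(* Induction strips the least prime divisor of [n], which is 3 or 5. *)
have [|||a [b E]] := IH (n %/ pdiv n)%N.
- by rewrite ltn_Pdiv ?prime_gt1 ?pdiv_prime.
- by rewrite divn_gt0 ?pdiv_gt0 // dvdn_leq.
- by move=> p prp pn; apply: prn => //; apply: dvdn_trans pn (dvdn_div pdvd).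
have nE : n = (3 ^ a * 5 ^ b * pdiv n)%N by rewrite -E divnK.
have [p3|p5] := prn _ (pdiv_prime n_gt1) pdvd.
- by exists a.+1, b; rewrite nE p3 mulnC mulnA expnS.
- by exists a, b.+1; rewrite nE p5 -mulnA expnSr.
Qed.

Local Close Scope group_scope.

Theorem corollaryE :
  (exists B3 B5 : nat -> finSkewBrace, forall m : nat,
     [/\ sb_simple (B3 m),
         ([set: add_group (B3 m)] \isog A5_power (3 ^ m))%g
       & solvable [set: circ_group (B3 m)]] /\
     [/\ sb_simple (B5 m),
         ([set: add_group (B5 m)] \isog A5_power (5 ^ m))%g
       & solvable [set: circ_group (B5 m)]]) /\
  (forall n : nat, 2 <= n ->
     (forall p : nat, prime p -> p %| n -> p = 3 \/ p = 5) ->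
     exists B : finSkewBrace,
       [/\ sb_simple B,
           ([set: add_group B] \isog A5_power n)%g
         & solvable [set: circ_group B]]).
Proof.
split.
  exists (fun m => A5_brace m 0), (fun m => A5_brace 0 m) => m.
  by split; apply: A5_braceP; rewrite ?muln1 ?mul1n.
move=> n n_gt1 /(prime_divisors_3_5 (ltnW n_gt1))[a [b nE]].
by exists (A5_brace a b); apply: A5_braceP.
Qed.
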